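(* Let $k>0$ be an even integer, let $(S^5,L_{k+1})$ be an NS-pair with $L_{k+1}$ diffeomorphic to the disjoint union of $k+1$ copies of $S^2$, and let $f:(\mathbb{R}^6,0)\to(\mathbb{R}^3,0)$ be a polynomial map germ with an isolated critical point at $0$ such that the NS-pair associated to $f$ is isomorphic to $(S^5,L_{k+1}\sharp(-L_{k+1}))$. Then the fiber of the Milnor fibration associated to $f$ is not diffeomorphic to a disk.
   Context: NS-pair: let $K$ be an oriented $(n-p-1)$-dimensional submanifold of the oriented sphere $S^{n-1}$ with trivial normal bundle (or $K=\emptyset$). Suppose that for some trivialization $c:N(K)\to K\times D^p$ of a tubular neighborhood $N(K)$ of $K$, the bundle $N(K)\setminus K\xrightarrow{c}K\times(D^p\setminus\{0\})\to S^{p-1}$, the last map being $(x,y)\mapsto y/\|y\|$, extends to a smooth fiber bundle $S^{n-1}\setminus K\to S^{p-1}$. Then $(S^{n-1},K)$ is called a Neuwirth--Stallings pair (NS-pair). Isomorphism of pairs means orientation-preserving diffeomorphism of pairs. A polynomial map germ $f:(\mathbb{R}^n,0)\to(\mathbb{R}^p,0)$ has an isolated singularity (critical point) at the origin if its derivative has rank $p$ at every point $x\ne0$ of some neighborhood of $0$. For $n\ge p\ge2$ and all sufficiently small $\varepsilon>0$, with $K=f^{-1}(0)\cap S^{n-1}_\varepsilon$ (the link), the complement of an open tubular neighborhood of $K$ in $S^{n-1}_\varepsilon$ is the total space of a smooth fiber bundle over $S^{p-1}$ (the Milnor fibration), each fiber being a smooth compact $(n-p)$-manifold bounded by a copy of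 $K$ (Milnor). The pair $(S^{n-1}_\varepsilon,K)$ is an NS-pair, with isomorphism type independent of $\varepsilon$, called the NS-pair associated to $f$. Here $S^{n-1}_\varepsilon$ is the sphere of radius $\varepsilon$ centered at $0$. $-L$ denotes $L$ with reversed orientation. $(S^5,L\sharp(-L))$ denotes the connected sum of pairs $(S^5,L)\sharp(S^5,-L)$: remove from each pair the interior of a small standard disk pair $(D^5,D^2)$ centered at a (corresponding) point of the submanifold and glue the remaining pairs along their boundary sphere pairs. *)

(* Defs.v *)
From mathcomp Require Import all_boot all_order all_algebra.
From mathcomp Require Import all_classical all_reals all_analysis.
From mathcomp Require mpoly.

Set Implicit Arguments.
Unset Strict Implicit.
Unset Printing Implicit Defensive.

Import Order.TTheory GRing.Theory Num.Theory.
Import numFieldNormedType.Exports.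

Local Open Scope classical_set_scope.
Local Open Scope ring_scope.

(* All manifolds are subsets of some R^n = 'rV[R]_n, with
   the smooth structure induced by R^n (smooth = locally the restriction of a
   C^oo map of the ambient space).  The library norm of 'rV[R]_n is the sup
   norm, hence the Euclidean norm [enorm] below. *)

Section Smooth.
Variable R : realType.

Fixpoint Ck (k n m : nat) (U : set 'rV[R]_n) (f : 'rV[R]_n -> 'rV[R]_m) : Prop :=
  if k is k'.+1 then
    (forall x, U x -> differentiable f x) /\
    (forall v, Ck k' U (fun x => 'D_v f x))
  else forall x, U x -> {for x, continuous f}.

Definition smooth_on n m (X : set 'rV[R]_n) (f : 'rV[R]_n -> 'rV[R]_m) : Prop :=
  forall x, X x -> exists U g,
    [/\ open U, U x, forall k, Ck k U g & forall y, X y -> U y -> g y = f y].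

(* Only the values of [f] on [X] matter. *)
Definition diffeo n m (X : set 'rV[R]_n) (Y : set 'rV[R]_m)
    (f : 'rV[R]_n -> 'rV[R]_m) : Prop :=
  [/\ smooth_on X f, (forall x, X x -> Y (f x)) &
      exists g : 'rV[R]_m -> 'rV[R]_n,
        [/\ smooth_on Y g, (forall y, Y y -> X (g y)),
            (forall x, X x -> g (f x) = x) & (forall y, Y y -> f (g y) = y)]].

Definition diffeomorphic n m (X : set 'rV[R]_n) (Y : set 'rV[R]_m) : Prop :=
  exists f, diffeo X Y f.

Definition embedding n m (X : set 'rV[R]_n) (f : 'rV[R]_n -> 'rV[R]_m) : Prop :=
  diffeo X (f @` X) f.

Definition enorm n (x : 'rV[R]_n) : R := Num.sqrt (\sum_i x 0 i ^+ 2).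

Definition sphere n (r : R) : set 'rV[R]_n := [set x | enorm x = r].
Definition cdisk n (r : R) : set 'rV[R]_n := [set x | enorm x <= r].
Definition odisk n (r : R) : set 'rV[R]_n := [set x | enorm x < r].

(* X * Y inside R^(n + m) *)
Definition prodset n m (X : set 'rV[R]_n) (Y : set 'rV[R]_m) : set 'rV[R]_(n + m) :=
  [set z | X (lsubmx z) /\ Y (rsubmx z)].

(* the disjoint union of [c] copies of the unit sphere of R^n, in R^(1 + n) *)
Definition sphere_copies (c n : nat) : set 'rV[R]_(1 + n) :=
  prodset [set t | exists2 i, (i < c)%N & t = const_mx i%:R] (@sphere n 1).

Definition local_param d n (X : set 'rV[R]_n) (U : set 'rV[R]_d)
    (phi : 'rV[R]_d -> 'rV[R]_n) : Prop :=
  [/\ open U, embedding U phi &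
      exists W : set 'rV[R]_n, open W /\ phi @` U = X `&` W].

(* A subset of R^n with an orientation: [orient x B] is the sign (0 if they are
   dependent) of the d tangent vectors at x given by the rows of B.  It is
   constrained only at points of the carrier and on tangent vectors.  Signs,
   rather than classes of bases, also make sense when d = 0. *)
Record oset (n d : nat) := Oset {
  carrier :> set 'rV[R]_n;
  orient : 'rV[R]_n -> 'M[R]_(d, n) -> R }.

(* The rows of [jacobian phi u] are the partial derivatives of phi at u. *)
Definition oriented_submanifold n d (X : oset n d) : Prop :=
  forall x, carrier X x -> exists U phi (s : bool),
    [/\ local_param X U phi, (phi @` U) x &
        forall u (A : 'M[R]_d), U u ->
          orient X (phi u) (A *m jacobian phi u) = (-1) ^+ s * Num.sg (\det A)].

Definition oreverse n d (X : oset n d) : oset n d :=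
  Oset X (fun x B => - orient X x B).

Definition orestrict n d (X : oset n d) (A : set 'rV[R]_n) : oset n d :=
  Oset (X `&` A) (orient X).

Definition orientation_preserving n m d (X : oset n d) (Y : oset m d)
    (h : 'rV[R]_n -> 'rV[R]_m) : Prop :=
  forall U phi u, local_param X U phi -> U u ->
    orient Y (h (phi u)) (jacobian (h \o phi) u)
    = orient X (phi u) (jacobian phi u).

(* oriented as the boundary of the ball, outward normal first *)
Definition osphere m (r : R) : oset m.+1 m :=
  Oset (@sphere m.+1 r) (fun x B => Num.sg (\det (col_mx x B : 'M[R]_m.+1))).

(* orientation-preserving diffeomorphism of the pairs (X, K) and (Y, J) *)
Definition pair_iso n m c d (X : oset n c) (K : oset n d)
    (Y : oset m c) (J : oset m d) : Prop :=
  exists h, [/\ diffeo X Y h, h @` K = J,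
    orientation_preserving X Y h & orientation_preserving K J h].

(* [c : N -> K * D^p] trivializes the tubular neighbourhood [N] of [K] in [M] *)
Definition tubular n p (M K N : set 'rV[R]_n) (c : 'rV[R]_n -> 'rV[R]_(n + p)) :
    Prop :=
  [/\ N `<=` M,
      exists W, [/\ open W, K `<=` W & M `&` W `<=` N],
      diffeo N (prodset K (@cdisk p 1)) c &
      forall x, K x -> c x = row_mx x 0].

Definition fiber n m (E : set 'rV[R]_n) (q : 'rV[R]_n -> 'rV[R]_m)
    (b : 'rV[R]_m) : set 'rV[R]_n := [set x | E x /\ q x = b].

Definition fiber_bundle n m (E : set 'rV[R]_n) (B : set 'rV[R]_m)
    (q : 'rV[R]_n -> 'rV[R]_m) : Prop :=
  [/\ smooth_on E q, (forall x, E x -> B (q x)) &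
      forall b, B b -> exists (W : set 'rV[R]_m) (h : 'rV[R]_n -> 'rV[R]_(m + n)),
        [/\ open W, W b,
            diffeo (E `&` q @^-1` W) (prodset (B `&` W) (fiber E q b)) h &
            forall x, E x -> W (q x) -> lsubmx (h x) = q x]].

(* Here the sphere is S^(n-1) with n = p + d + 1, so that d = n - p - 1.  For
   S \ K to be a manifold, K has to be closed. *)
Definition NS_pair p d (K : oset (p + d).+1 d) : Prop :=
  let S := @sphere (p + d).+1 1 in
  [/\ K `<=` S, closed K, oriented_submanifold K &
      exists N (c : 'rV[R]_(p + d).+1 -> 'rV[R]_((p + d).+1 + p)) q,
        [/\ tubular S K N c,
            fiber_bundle (S `\` K) (@sphere p 1) q &
            forall x, N x -> ~ carrier K x ->
              q x = (enorm (rsubmx (c x)))^-1 *: rsubmx (c x)]].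

(* [e] embeds the standard disk pair (D^(p+d), 0 * D^d) in (S^(p+d), L), with
   centre [x]; it preserves (s = false) or reverses (s = true) the orientations
   of both the sphere and L. *)
Definition disk_pair p d (L : oset (p + d).+1 d) (x : 'rV[R]_(p + d).+1)
    (s : bool) (e : 'rV[R]_(p + d) -> 'rV[R]_(p + d).+1) : Prop :=
  let S := osphere (p + d) 1 in
  let e' := fun u : 'rV[R]_d => e (row_mx 0 u) in
  [/\ embedding (@cdisk (p + d) 1) e /\ e @` @cdisk (p + d) 1 `<=` S,
      e 0 = x,
      (forall y, @cdisk (p + d) 1 y -> (carrier L (e y) <-> lsubmx y = 0)),
      (forall y, @odisk (p + d) 1 y -> orient S (e y) (jacobian e y) = (-1) ^+ s) &
      (forall u, @odisk d 1 u -> orient L (e' u) (jacobian e' u) = (-1) ^+ s)].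

(* (S^(p+d), J) is a connected sum of the pairs (S^(p+d), L1) and (S^(p+d), L2)
   at x1 and x2.  The maps i1, i2 present (S^(p+d), J) as the union of the
   complements of the two open disk pairs, glued along the boundary spheres by
   e1 v ~ e2 v.  As e1 preserves and e2 reverses orientations, those of both
   pieces extend to the union. *)
Definition connected_sum p d (L1 L2 : oset (p + d).+1 d)
    (x1 x2 : 'rV[R]_(p + d).+1) (J : oset (p + d).+1 d) : Prop :=
  let S := osphere (p + d) 1 in
  exists e1 e2 (i1 i2 : 'rV[R]_(p + d).+1 -> 'rV[R]_(p + d).+1),
    let A1 := S `\` e1 @` @odisk (p + d) 1 in
    let A2 := S `\` e2 @` @odisk (p + d) 1 in
    let C1 := ~` (e1 @` @cdisk (p + d) 1) in
    let C2 := ~` (e2 @` @cdisk (p + d) 1) in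
    [/\ disk_pair L1 x1 false e1 /\ disk_pair L2 x2 true e2,
        embedding A1 i1 /\ embedding A2 i2,
        i1 @` A1 `|` i2 @` A2 = S /\
        (forall y1 y2, A1 y1 -> A2 y2 -> (i1 y1 = i2 y2 <->
           exists v, [/\ @sphere (p + d) 1 v, y1 = e1 v & y2 = e2 v])),
        [/\ carrier J = i1 @` (L1 `&` A1) `|` i2 @` (L2 `&` A2) &
            oriented_submanifold J] &
        [/\ orientation_preserving (orestrict S C1) S i1,
            orientation_preserving (orestrict S C2) S i2,
            orientation_preserving (orestrict L1 C1) J i1 &
            orientation_preserving (orestrict L2 C2) J i2]].

Definition polymap n p (F : 'I_p -> mpoly.mpoly n R) (x : 'rV[R]_n) : 'rV[R]_p :=
  \row_i mpoly.meval (fun j => x 0 j) (F i).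

Definition isolated_critical_point n p (f : 'rV[R]_n -> 'rV[R]_p) : Prop :=
  \forall x \near (0 : 'rV[R]_n), x != 0 -> \rank (jacobian f x) = p.

(* The link f^-1(0) in the sphere of radius e, oriented as the preimage of the
   regular value 0 of f restricted to the sphere: the normal frame, mapped by
   the differential to the standard basis of R^p, comes first.  The p gradients
   (the rows of the transposed jacobian), projected to the tangent space of the
   sphere, define the same normal orientation, since their Gram matrix has
   positive determinant; the row [x] makes the projection unnecessary. *)
Definition link p d (f : 'rV[R]_(p + d).+1 -> 'rV[R]_p) (e : R) :
    oset (p + d).+1 d :=
  Oset [set x | @sphere (p + d).+1 e x /\ f x = 0]
       (fun x B => Num.sg (\det (col_mx x (col_mx (jacobian f x)^T B)
                                 : 'M[R]_((p + d).+1)))).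

(* the isomorphism type of (S_e, link f e) does not depend on the small e *)
Definition associated_pair_iso p d (f : 'rV[R]_(p + d).+1 -> 'rV[R]_p)
    (J : oset (p + d).+1 d) : Prop :=
  \forall e \near 0^'+,
    pair_iso (osphere (p + d) e) (link f e) (osphere (p + d) 1) J.

(* the complement in S_e of the open tubular neighbourhood {|f| < a} of the link *)
Definition milnor_total n p (f : 'rV[R]_n -> 'rV[R]_p) (e a : R) : set 'rV[R]_n :=
  [set x | @sphere n e x /\ a <= enorm (f x)].

(* The Milnor fibration, for 0 < a << e << 1.  Milnor's construction starts from
   the bundle f : {|x| <= e, |f x| = a} -> S_a and carries its total space to
   [milnor_total f e a] by a diffeomorphism Phi (obtained by following a vector
   field outwards), which fixes the boundary {|x| = e, |f x| = a}.  There q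
   is f / a, which trivializes the tubular neighbourhood {|f| <= a}. *)
Definition milnor_fibration n p (f : 'rV[R]_n -> 'rV[R]_p) (e a : R)
    (q : 'rV[R]_n -> 'rV[R]_p) : Prop :=
  let S := @sphere n e in
  let N := [set x | S x /\ enorm (f x) <= a] in
  let T := [set x | enorm x <= e /\ enorm (f x) = a] in
  [/\ exists2 c : 'rV[R]_n -> 'rV[R]_(n + p),
        tubular S [set x | S x /\ f x = 0] N c &
        forall x, N x -> rsubmx (c x) = a^-1 *: f x,
      fiber_bundle (milnor_total f e a) (@sphere p 1) q &
      exists Phi : 'rV[R]_n -> 'rV[R]_n,
        [/\ diffeo T (milnor_total f e a) Phi,
            forall x, T x -> S x -> Phi x = x &
            forall x, T x -> q (Phi x) = a^-1 *: f x]].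

End Smooth.

Arguments sphere {R} n r.
Arguments cdisk {R} n r.
Arguments odisk {R} n r.
Arguments sphere_copies {R} c n.
Arguments osphere {R} m r.

(* Main.v *)
Require Import Defs.
From mathcomp Require Import all_boot all_order all_algebra.
From mathcomp Require Import all_classical all_reals all_analysis.
From mathcomp Require Import ring lra.
From mathcomp Require mpoly.

Set Implicit Arguments.
Unset Strict Implicit.
Unset Printing Implicit Defensive.

Import Order.TTheory GRing.Theory Num.Theory.
Import numFieldNormedType.Exports.

Local Open Scope classical_set_scope.
Local Open Scope ring_scope.

(** If the fiber were a 3-disk, its boundary would be a 2-sphere, hence connected.
The boundary of the fiber is a copy of the link, so the link would be connected.
But the link is diffeomorphic to the connected sum of [L] with its reverse,
and [L] has [k + 1 >= 2] components, only one of which meets the disk removed: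
another component survives as a separate piece of the sum.

Two points need an argument.

The diffeomorphism between the fiber and the disk has to respect boundaries, and
the fiber is only known through the local trivializations of the Milnor
fibration.  Boundary points are detected by a diffeomorphism invariant: a set is
[two_sided] at a point if its cone of tangent vectors there (velocities of
one-sided curves staying in the set) is symmetric.  This is preserved by
diffeomorphisms ([diffeo_two_sided]) and by products with a two-sided factor
([two_sided_prodset]).  A closed disk is two-sided exactly at its interior points
([two_sided_cdisk]), and the total space of the Milnor fibration is two-sided
exactly where [a < enorm (f z)] ([two_sided_milnor_total]).  A trivialization
over a piece of the base sphere transfers the property from the total space to
the fiber ([fiber_bundle_two_sided]).  Hence the unit sphere maps continuously
onto the part [enorm (f z) = a] of the fiber ([connected_fiber_boundary]), and the
tubular neighborhood maps that part onto the link ([connected_link]).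

Separating the connected sum into two closed pieces requires that an open disk
embedded in the sphere be open ([closed_sphere_minus_disk]).  This is invariance
of domain, which for smooth embeddings follows from minimizing a distance: at a
nearest point the difference is normal to the image, hence radial, hence zero.
The separation itself is [connected_sum_not_connected]. *)

(** * The Euclidean inner product and norm *)

Section EuclideanNorm.
Variable R : realType.
Implicit Types (n : nat).

Definition dot n (u v : 'rV[R]_n) : R := (u *m v^T) 0 0.

Lemma dotE n (u v : 'rV[R]_n) : dot u v = \sum_i u 0 i * v 0 i.
Proof. by rewrite /dot mxE; apply: eq_bigr => i _; rewrite mxE. Qed.

Lemma dotC n (u v : 'rV[R]_n) : dot u v = dot v u.
Proof. by rewrite !dotE; apply: eq_bigr => i _; rewrite mulrC. Qed.

Lemma dotDl n (u v w : 'rV[R]_n) : dot (u + v) w = dot u w + dot v w.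
Proof. by rewrite /dot mulmxDl mxE. Qed.

Lemma dotZl n a (u v : 'rV[R]_n) : dot (a *: u) v = a * dot u v.
Proof. by rewrite /dot -scalemxAl mxE. Qed.

Lemma dotNl n (u v : 'rV[R]_n) : dot (- u) v = - dot u v.
Proof. by rewrite -scaleN1r dotZl mulN1r. Qed.

Lemma dotDr n (u v w : 'rV[R]_n) : dot w (u + v) = dot w u + dot w v.
Proof. by rewrite dotC dotDl !(dotC w). Qed.

Lemma dotZr n a (u v : 'rV[R]_n) : dot u (a *: v) = a * dot u v.
Proof. by rewrite dotC dotZl dotC. Qed.

Lemma dotNr n (u v : 'rV[R]_n) : dot u (- v) = - dot u v.
Proof. by rewrite dotC dotNl dotC. Qed.

Lemma dot_ge0 n (u : 'rV[R]_n) : 0 <= dot u u.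
Proof. by rewrite dotE; apply: sumr_ge0 => i _; rewrite -expr2 sqr_ge0. Qed.

Lemma dot_eq0 n (u : 'rV[R]_n) : (dot u u == 0) = (u == 0).
Proof.
apply/idP/eqP => [|->]; last by rewrite /dot mul0mx mxE.
rewrite dotE psumr_eq0 => [/allP u0|i _]; last by rewrite -expr2 sqr_ge0.
apply/rowP => i; rewrite mxE; apply/eqP; rewrite -sqrf_eq0 expr2.
by have := u0 i; rewrite mem_index_enum => /(_ isT).
Qed.

Lemma enormE n (u : 'rV[R]_n) : enorm u = Num.sqrt (dot u u).
Proof. by rewrite /enorm dotE; congr Num.sqrt; apply: eq_bigr => i _; rewrite expr2. Qed.

Lemma enorm_ge0 n (u : 'rV[R]_n) : 0 <= enorm u.
Proof. exact: sqrtr_ge0. Qed.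

Lemma enorm_sqr n (u : 'rV[R]_n) : enorm u ^+ 2 = dot u u.
Proof. by rewrite enormE sqr_sqrtr ?dot_ge0. Qed.

Lemma enorm_eq n (u : 'rV[R]_n) r : 0 <= r -> (enorm u = r) <-> (dot u u = r ^+ 2).
Proof.
move=> r0; rewrite -enorm_sqr; split => [->//|/eqP].
by rewrite eqrXn2 ?enorm_ge0// => /eqP.
Qed.

Lemma enorm_le n (u : 'rV[R]_n) r : 0 <= r -> (enorm u <= r) = (dot u u <= r ^+ 2).
Proof. by move=> r0; rewrite -enorm_sqr ler_pXn2r ?nnegrE ?enorm_ge0. Qed.

Lemma enorm_lt n (u : 'rV[R]_n) r : 0 <= r -> (enorm u < r) = (dot u u < r ^+ 2).
Proof. by move=> r0; rewrite -enorm_sqr ltr_pXn2r ?nnegrE ?enorm_ge0. Qed.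

Lemma enorm0 n : enorm (0 : 'rV[R]_n) = 0.
Proof. by rewrite enormE /dot mul0mx mxE sqrtr0. Qed.

Lemma enormZ n a (u : 'rV[R]_n) : enorm (a *: u) = `|a| * enorm u.
Proof.
by rewrite !enormE dotZl dotZr mulrA -expr2 sqrtrM ?sqr_ge0// sqrtr_sqr.
Qed.

Lemma enorm_eq0 n (u : 'rV[R]_n) : (enorm u == 0) = (u == 0).
Proof.
by rewrite -dot_eq0 -enorm_sqr sqrf_eq0.
Qed.

Lemma dot_row_mx m n (u u' : 'rV[R]_m) (v v' : 'rV[R]_n) :
  dot (row_mx u v) (row_mx u' v') = dot u u' + dot v v'.
Proof. by rewrite /dot tr_row_mx mul_row_col mxE. Qed.

(** The library norm of row vectors is the sup norm; this comparison is what turns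
Euclidean bounds into bounded sets and neighborhoods. *)
Lemma norm_le_enorm n (u : 'rV[R]_n) : `|u| <= enorm u.
Proof.
rewrite [leLHS]/Num.norm /= mx_normrE; apply/bigmax_leP.
split => [|[i j] _ /=]; first exact: enorm_ge0.
rewrite ord1 -ler_sqr ?nnegrE ?enorm_ge0// enorm_sqr dotE real_normK ?num_real//.
by rewrite (bigD1 j)//= expr2 lerDl sumr_ge0// => k _; rewrite -expr2 sqr_ge0.
Qed.

Lemma cvg_dot n T (F : set_system T) {FF : Filter F} (f g : T -> 'rV[R]_n) u v :
  f @ F --> u -> g @ F --> v -> (fun t => dot (f t) (g t)) @ F --> dot u v.
Proof.
move=> fu gv; rewrite dotE.
under eq_fun do rewrite dotE.
apply: (@cvg_big R 'I_n +%R) => [|i _]; [exact: add_continuous|apply: cvgM].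
  exact: (cvg_comp _ _ fu (@coord_continuous R 1 n 0 i u)).
exact: (cvg_comp _ _ gv (@coord_continuous R 1 n 0 i v)).
Qed.

Lemma cvg_enorm n T (F : set_system T) {FF : Filter F} (f : T -> 'rV[R]_n) u :
  f @ F --> u -> (fun t => enorm (f t)) @ F --> enorm u.
Proof.
move=> fu; rewrite enormE; under eq_fun do rewrite enormE.
exact: (cvg_comp _ _ (cvg_dot fu fu) (@sqrt_continuous R _)).
Qed.

Lemma enorm_continuous n : continuous (@enorm R n).
Proof. by move=> x; apply: (@cvg_enorm n _ (nbhs x) _ id); exact: cvg_id. Qed.

End EuclideanNorm.

(** * Tangent cones and two-sided points *)

Section Tangent.
Variable R : realType.

(** The one-sided derivative at [0] of a curve that starts at [x].  The value [g 0]
is irrelevant, so curves only have to be specified for [t > 0]. *)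
Definition velocity n (g : R -> 'rV[R]_n) (x v : 'rV[R]_n) : Prop :=
  t^-1 *: (g t - x) @[t --> 0^'+] --> v.

Definition tangent n (X : set 'rV[R]_n) (x v : 'rV[R]_n) : Prop :=
  exists2 g, (\forall t \near (0 : R)^'+, X (g t)) & velocity g x v.

(** Symmetry of the tangent cone.  At a point of a manifold with boundary the cone
is a vector space or a half-space according to whether the point is interior,
so this singles out the interior points. *)
Definition two_sided n (X : set 'rV[R]_n) (x : 'rV[R]_n) : Prop :=
  forall v, tangent X x v -> tangent X x (- v).

Lemma near_right_neq0 : \forall t \near (0 : R)^'+, t != 0.
Proof. by near=> t; rewrite gt_eqF//; near: t; exact: nbhs_right_gt. Unshelve. all: by end_near. Qed.

Lemma cvg_right_id : t @[t --> (0 : R)^'+] --> (0 : R).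
Proof. exact: cvg_within. Qed.

Lemma velocity_cvg n g (x v : 'rV[R]_n) : velocity g x v -> g t @[t --> 0^'+] --> x.
Proof.
move=> gv.
have : (t *: (t^-1 *: (g t - x)) + x) @[t --> 0^'+] --> 0 *: v + x.
  by apply: cvgD; [apply: cvgZ => //; exact: cvg_right_id|exact: cvg_cst].
rewrite scale0r add0r; apply: cvg_trans; apply: near_eq_cvg.
by apply: filterS near_right_neq0 => t t0; rewrite scalerA mulfV ?scale1r ?subrK.
Qed.

Lemma velocity_unique n g (x v w : 'rV[R]_n) :
  velocity g x v -> velocity g x w -> v = w.
Proof. exact: cvg_unique. Qed.

Lemma velocity_near_eq n g g' (x v : 'rV[R]_n) :
  (\forall t \near (0 : R)^'+, g t = g' t) -> velocity g x v -> velocity g' x v.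
Proof.
move=> gg'; apply: cvg_trans; apply: near_eq_cvg.
by apply: filterS gg' => t ->.
Qed.

(** The derivative of the squared norm along the curve, written without naming it
as a real-valued derivative. *)
Lemma velocity_dot n g (x v : 'rV[R]_n) : velocity g x v ->
  t^-1 * (dot (g t) (g t) - dot x x) @[t --> 0^'+] --> 2 * dot v x.
Proof.
move=> gv; have gx := velocity_cvg gv.
have -> : 2 * dot v x = dot v (x + x) by rewrite dotDr; ring.
have : dot (t^-1 *: (g t - x)) (g t + x) @[t --> 0^'+] --> dot v (x + x).
  by apply: cvg_dot; [exact: gv|apply: cvgD => //; exact: cvg_cst].
apply: cvg_trans; apply: near_eq_cvg; apply: nearW => t /=.
rewrite dotZl dotDl dotNl !dotDr (dotC x (g t)); congr (_ * _); ring.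
Qed.

(** Chain rule: the remainder of [f] at [x] is [o(g t - x)], and
[t^-1 *: (g t - x)] is bounded because it converges. *)
Lemma velocity_diff n m (f : 'rV[R]_n -> 'rV[R]_m) g x v :
  differentiable f x -> velocity g x v -> velocity (f \o g) (f x) ('d f x v).
Proof.
move=> df gv; have gx := velocity_cvg gv.
have dfc := diff_continuous df.
have fgE : \forall t \near (0 : R)^'+,
    'd f x (t^-1 *: (g t - x)) +
      t^-1 *: (f (g t) - f x - 'd f x (g t - x)) = t^-1 *: (f (g t) - f x).
  by near=> t; rewrite linearZ -scalerDr addrC subrK.
rewrite /velocity -[X in _ --> X]addr0.
apply: cvg_trans (near_eq_cvg fgE) _; apply: cvgD.
  exact: (cvg_comp _ _ gv (dfc v)).
apply/cvgr0Pnorm_le => eps eps0.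
have h0 : g t - x @[t --> (0 : R)^'+] --> (0 : 'rV[R]_n).
  by rewrite -(subrr x); apply: cvgB => //; exact: cvg_cst.
pose d := eps / (`|v| + 1).
have d0 : 0 < d by rewrite divr_gt0// ltr_wpDl.
have := diff_locally df => /eqaddoP/(_ _ d0) /h0.
move=> hd.
have {}hd : \forall t \near (0 : R)^'+,
    `|f (g t) - f x - 'd f x (g t - x)| <= d * `|g t - x|.
  apply: (@filterS _ (nbhs (0 : R)^'+) _ _ _ _ hd) => t /=.
  have -> // : (f \o shift x - (cst (f x) + 'd f x)) (g t - x)
      = f (g t) - f x - 'd f x (g t - x).
  rewrite -[LHS]/(f (g t - x + x) - (f x + 'd f x (g t - x))).
  by rewrite subrK opprD addrA.
have vb : \forall t \near (0 : R)^'+, `|t^-1 *: (g t - x)| <= `|v| + 1.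
  by apply: cvgr_norm_le gv _ _; rewrite ltrDl.
near=> t.
have t0 : t != 0 by near: t; exact: near_right_neq0.
have ht : `|f (g t) - f x - 'd f x (g t - x)| <= d * `|g t - x| by near: t.
rewrite normrZ (le_trans (ler_wpM2l (normr_ge0 _) ht))// mulrCA -normrZ.
have v1 : 0 < `|v| + 1 by rewrite ltr_wpDl.
rewrite -[leRHS](divfK (lt0r_neq0 v1)).
apply: ler_wpM2l; first exact: ltW.
by near: t.
Unshelve. all: by end_near. Qed.

Lemma tangent_near n (X Y : set 'rV[R]_n) x v :
  (\forall y \near x, X y -> Y y) -> tangent X x v -> tangent Y x v.
Proof.
move=> XY [g gX gv]; exists g => //.
by apply: filterS2 gX (velocity_cvg gv XY) => t Xt; exact.
Qed.

Lemma two_sided_near n (X Y : set 'rV[R]_n) x :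
  (\forall y \near x, X y <-> Y y) -> two_sided X x -> two_sided Y x.
Proof.
move=> XY Xx v Yv; apply: (@tangent_near _ X).
  by apply: filterS XY => y [].
by apply: Xx; apply: tangent_near Yv; apply: filterS XY => y [].
Qed.

(** A map that is smooth on [X] is only controlled through local extensions; first
order information is read off one of them. *)
Lemma smooth_on_diff n m (X : set 'rV[R]_n) (f : 'rV[R]_n -> 'rV[R]_m) x :
  smooth_on X f -> X x -> exists g, [/\ differentiable g x, g x = f x &
    \forall y \near x, X y -> g y = f y].
Proof.
move=> sf Xx; have [U [g [oU Ux Ug gf]]] := sf x Xx.
exists g; split; [exact: (Ug 1%N).1|exact: gf|].
have : nbhs x U by exact: open_nbhs_nbhs.
by apply: filterS => y Uy Xy; exact: gf.
Qed.

Lemma smooth_on_cvg n m (X : set 'rV[R]_n) (f : 'rV[R]_n -> 'rV[R]_m) x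
    (T : Type) (F : set_system T) {FF : Filter F} (u : T -> 'rV[R]_n) :
  smooth_on X f -> X x -> (\forall t \near F, X (u t)) -> u @ F --> x ->
  f \o u @ F --> f x.
Proof.
move=> sf Xx uX ux; have [g [dg gx gf]] := smooth_on_diff sf Xx.
have := cvg_comp _ _ ux (differentiable_continuous dg).
rewrite gx; apply: cvg_trans; apply: near_eq_cvg.
by apply: filterS2 uX (ux _ gf) => t Xt; exact.
Qed.

Lemma smooth_on_continuous n m (X : set 'rV[R]_n) (f : 'rV[R]_n -> 'rV[R]_m) :
  smooth_on X f -> {within X, continuous f}.
Proof.
move=> sf; apply/subspace_continuousP => x Xx.
apply: (@smooth_on_cvg _ _ X f x _ (within X (nbhs x)) _ id) => //.
  exact: withinT.
exact: cvg_within.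
Qed.

(** Different extensions of [f] may have different derivatives, but any fixed one
computes the velocities of the images of curves in [X]; hence the order of the
quantifiers. *)
Lemma smooth_on_velocity n m (X : set 'rV[R]_n) (f : 'rV[R]_n -> 'rV[R]_m) x :
  smooth_on X f -> X x ->
  exists D : {linear 'rV[R]_n -> 'rV[R]_m}, forall g v,
    (\forall t \near (0 : R)^'+, X (g t)) -> velocity g x v ->
    velocity (f \o g) (f x) (D v).
Proof.
move=> sf Xx; have [h [dh hx hf]] := smooth_on_diff sf Xx.
exists ('d h x) => g v gX gv; rewrite -hx.
apply: velocity_near_eq (velocity_diff dh gv).
by apply: filterS2 gX (velocity_cvg gv hf) => t Xt; exact.
Qed.

(** The derivatives [D] of [f] and [E] of its inverse need not be inverse linear
maps, as they come from extensions to ambient spaces.  They are inverse on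
tangent vectors, because the composite fixes every curve in [Y]: to reflect a
tangent vector of [Y], pull it back, reflect it, and push it forward. *)
Lemma diffeo_two_sided n m (X : set 'rV[R]_n) (Y : set 'rV[R]_m) f x :
  diffeo X Y f -> X x -> two_sided X x <-> two_sided Y (f x).
Proof.
wlog suff two : n m X Y f x / diffeo X Y f -> X x -> two_sided X x -> two_sided Y (f x).
  move=> fXY Xx; split; first exact: two fXY Xx.
  have [fs XY [g [gs YX gK fK]]] := fXY.
  rewrite -{2}(gK _ Xx); apply: (two _ _ _ _ g) => //; last exact: XY.
  by split => //; exists f.
move=> [fs XY [g [gs YX gK fK]]] Xx twoX w [c cY cw].
have [D Dv] := smooth_on_velocity fs Xx.
have [E Ev] := smooth_on_velocity gs (XY _ Xx).
rewrite gK// in Ev.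
have gcX : \forall t \near (0 : R)^'+, X (g (c t)).
  by apply: filterS cY => t; exact: YX.
have gcv := Ev _ _ cY cw.
have DEw : D (E w) = w.
  apply: (velocity_unique (Dv _ _ gcX gcv)); apply: velocity_near_eq cw.
  by apply: filterS cY => t Yt /=; rewrite fK.
have [c' c'X c'v] : tangent X x (- E w) by apply: twoX; exists (g \o c).
exists (f \o c'); first by apply: filterS c'X => t; exact: XY.
by rewrite -DEw -linearN; exact: Dv.
Qed.

End Tangent.

(** * Spheres, disks and products *)

Section Models.
Variable R : realType.

Lemma velocity_line n (x v : 'rV[R]_n) : velocity (fun t => x + t *: v) x v.
Proof.
have : (fun=> v) @ (0 : R)^'+ --> v by exact: cvg_cst.
apply: cvg_trans; apply: near_eq_cvg.
by apply: filterS (@near_right_neq0 R) => t t0; rewrite addrC addKr scalerA mulVf ?scale1r.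
Qed.

Lemma tangent_line n (X : set 'rV[R]_n) x v :
  (\forall t \near (0 : R)^'+, X (x + t *: v)) -> tangent X x v.
Proof. by move=> Xt; exists (fun t => x + t *: v) => //; exact: velocity_line. Qed.

Lemma near_line n (X : set 'rV[R]_n) (x v : 'rV[R]_n) :
  nbhs x X -> \forall t \near (0 : R)^'+, X (x + t *: v).
Proof. by move=> Xx; exact: (velocity_cvg (@velocity_line n x v) Xx). Qed.

Lemma two_sided_interior n (X : set 'rV[R]_n) x : nbhs x X -> two_sided X x.
Proof. by move=> Xx v _; apply: tangent_line; exact: near_line. Qed.

Lemma tangent_sphere_dot n r (x v : 'rV[R]_n) :
  sphere n r x -> tangent (sphere n r) x v -> dot v x = 0.
Proof.
move=> xr [g gS /velocity_dot gv].
have : (fun=> 0 : R) @ (0 : R)^'+ --> 2 * dot v x.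
  apply: cvg_trans gv; apply: near_eq_cvg; apply: filterS gS => t gt.
  by rewrite -!enorm_sqr gt xr subrr mulr0.
move=> /(cvg_unique (@Rhausdorff R) (cvg_cst 0))/eqP.
by rewrite eq_sym mulf_eq0 pnatr_eq0/= => /eqP.
Qed.

(** The curve is obtained from the rational parametrization of the circle through
[x] with direction [v], which avoids differentiating a square root. *)
Lemma tangent_sphere n r (x v : 'rV[R]_n) : 0 < r ->
  sphere n r x -> dot v x = 0 -> tangent (sphere n r) x v.
Proof.
move=> r0 xr vx; pose c := dot v v / (4 * r ^+ 2).
have c0 : 0 <= c by rewrite divr_ge0 ?dot_ge0// mulr_ge0// sqr_ge0.
have cr : c * (4 * r ^+ 2) = dot v v by rewrite divfK// mulf_neq0// sqrf_eq0 gt_eqF.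
have xx : dot x x = r ^+ 2 by rewrite -enorm_sqr xr.
pose k (t : R) := (1 + c * t ^+ 2)^-1.
have k0 t : 1 + c * t ^+ 2 != 0 by rewrite gt_eqF// ltr_pwDl// mulr_ge0// sqr_ge0.
exists (fun t => k t *: ((1 - c * t ^+ 2) *: x + t *: v)).
  apply: nearW => t; apply/enorm_eq; first exact: ltW.
  rewrite dotZl dotZr !(dotDl, dotDr, dotZl, dotZr) (dotC x v) vx xx -cr /k.
  by field; exact: k0.
have cv : k t *: (v - (2 * c * t) *: x) @[t --> (0 : R)^'+] --> v.
  have {2}-> : v = k 0 *: (v - (2 * c * 0) *: x).
    by rewrite /k expr0n/= mulr0 addr0 invr1 scale1r mulr0 scale0r subr0.
  apply: cvgZ.
    apply: cvgV; first exact: k0.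
    apply: cvgD; first exact: cvg_cst.
    apply: cvgMr; rewrite expr2; under eq_fun do rewrite expr2.
    by apply: cvgM; exact: cvg_right_id.
  apply: cvgB; first exact: cvg_cst.
  by apply: cvgZl; apply: cvgMr; exact: cvg_right_id.
apply: cvg_trans cv; apply: near_eq_cvg.
apply: filterS (@near_right_neq0 R) => t t0.
apply/rowP => i; rewrite !mxE /k.
by field; rewrite t0 k0.
Qed.

Lemma two_sided_sphere n r (x : 'rV[R]_n) : 0 < r ->
  sphere n r x -> two_sided (sphere n r) x.
Proof.
move=> r0 xr v /(tangent_sphere_dot xr) vx.
by apply: tangent_sphere => //; rewrite dotNl vx oppr0.
Qed.

Lemma nbhs_cdisk n r (x : 'rV[R]_n) : enorm x < r -> nbhs x (cdisk n r).
Proof. exact: (cvgr_le _ (@enorm_continuous R n x)). Qed.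

(** At a boundary point [x] the vector [- x] is tangent, while [x] is not: the norm
would increase along the curve. *)
Lemma two_sided_cdisk n r (x : 'rV[R]_n) : 0 < r -> enorm x <= r ->
  two_sided (cdisk n r) x <-> enorm x < r.
Proof.
move=> r0 xr; split=> [x2|{}xr]; last first.
  by apply: two_sided_interior; exact: nbhs_cdisk.
rewrite lt_neqAle xr andbT; apply/eqP => {}xr.
have xx : dot x x = r ^+ 2 by rewrite -enorm_sqr xr.
have : tangent (cdisk n r) x x.
  rewrite -[X in tangent _ _ X]opprK; apply: x2; apply: tangent_line.
  near=> t; rewrite /cdisk/= scalerN -[X in X - _]scale1r -scalerBl enormZ xr.
  have t0 : 0 < t by near: t; exact: nbhs_right_gt.
  have t1 : t <= 1 by near: t; exact: nbhs_right_le.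
  by rewrite ger0_norm ?subr_ge0// ler_piMl ?(ltW r0)// lerBlDr lerDl ltW.
move=> [g gD /velocity_dot gv].
suff : 2 * dot x x <= 0 by rewrite xx leNgt mulr_gt0// exprn_gt0.
apply: (ler_cvg_to gv (cvg_cst 0)).
near=> t.
have t0 : 0 < t by near: t; exact: nbhs_right_gt.
have gt : cdisk n r (g t) by near: t; exact: gD.
by rewrite pmulr_rle0 ?invr_gt0// subr_le0 xx -(enorm_le _ (ltW r0)).
Unshelve. all: by end_near. Qed.

Lemma tangent0 n (X : set 'rV[R]_n) x : X x -> tangent X x 0.
Proof. by move=> Xx; apply: tangent_line; apply: nearW => t; rewrite scaler0 addr0. Qed.

Lemma cvg_rV n T (F : set_system T) {FF : Filter F} (f : T -> 'rV[R]_n) (u : 'rV[R]_n) :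
  (forall i, f t 0 i @[t --> F] --> u 0 i) -> f @ F --> u.
Proof.
move=> fu; apply/cvgrPdist_le => /= e e0; near=> t.
rewrite [leLHS]/Num.norm/= mx_normrE (bigmax_le _ (ltW e0))//= => -[i j] _ /=.
rewrite ord1 !mxE; move: j; near: t; apply: filter_forall => j.
exact: ((cvgrPdist_le _ _).1 (fu j)).
Unshelve. all: by end_near. Qed.

Lemma cvg_row_mx m n T (F : set_system T) {FF : Filter F}
    (f : T -> 'rV[R]_m) (g : T -> 'rV[R]_n) (u : 'rV[R]_m) (v : 'rV[R]_n) :
  f @ F --> u -> g @ F --> v -> (fun t => row_mx (f t) (g t)) @ F --> row_mx u v.
Proof.
move=> fu gv; apply: cvg_rV => i; rewrite mxE; under eq_fun do rewrite mxE.
case: (fintype.split i) => j.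
  exact: (cvg_comp _ _ fu (@coord_continuous R 1 m 0 j u)).
exact: (cvg_comp _ _ gv (@coord_continuous R 1 n 0 j v)).
Qed.

Lemma tangent_prodset m n (X : set 'rV[R]_m) (Y : set 'rV[R]_n) z v :
  tangent (prodset X Y) z v <->
  tangent X (lsubmx z) (lsubmx v) /\ tangent Y (rsubmx z) (rsubmx v).
Proof.
split=> [[g gXY gv]|[[f fX fv] [g gY gv]]].
  split.
    exists (lsubmx \o g); first by apply: filterS gXY => t [].
    have := cvg_comp _ _ gv (@continuous_lsubmx R 1 m n v).
    apply: cvg_trans; apply: near_eq_cvg; apply: nearW => t /=.
    by rewrite linearZ linearB.
  exists (rsubmx \o g); first by apply: filterS gXY => t [].
  have := cvg_comp _ _ gv (@continuous_rsubmx R 1 m n v).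
  apply: cvg_trans; apply: near_eq_cvg; apply: nearW => t /=.
  by rewrite linearZ linearB.
exists (fun t => row_mx (f t) (g t)).
  by apply: filterS2 fX gY => t ? ?; split; rewrite ?row_mxKl ?row_mxKr.
have : row_mx (t^-1 *: (f t - lsubmx z)) (t^-1 *: (g t - rsubmx z))
    @[t --> (0 : R)^'+] --> v by rewrite -[v]hsubmxK; exact: cvg_row_mx.
apply: cvg_trans; apply: near_eq_cvg; apply: nearW => t /=.
by rewrite -[in RHS](hsubmxK z) -scale_row_mx opp_row_mx add_row_mx.
Qed.

Lemma two_sided_prodset m n (X : set 'rV[R]_m) (Y : set 'rV[R]_n) z :
  X (lsubmx z) -> two_sided X (lsubmx z) ->
  two_sided (prodset X Y) z <-> two_sided Y (rsubmx z).
Proof.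
move=> Xz X2; split=> [XY2 w Yw|Y2 v /tangent_prodset[Xv Yv]]; last first.
  by apply/tangent_prodset; rewrite !linearN; split; [exact: X2|exact: Y2].
have : tangent (prodset X Y) z (row_mx 0 w).
  by apply/tangent_prodset; rewrite row_mxKl row_mxKr; split => //; exact: tangent0.
by move/XY2/tangent_prodset => [_]; rewrite linearN /= row_mxKr.
Qed.

(** The points other than the antipode of [p] are joined to [p] by normalized
segments; the sphere is the union of two such star-shaped parts, for opposite
values of [p], which meet as soon as the dimension is positive. *)
Lemma connected_sphere n : connected (sphere n.+2 (1 : R)).
Proof.
pose nor (x : 'rV[R]_n.+2) := (enorm x)^-1 *: x.
pose A (p : 'rV[R]_n.+2) := [set q | sphere n.+2 1 q /\ q != - p].
have norE x : sphere n.+2 1 x -> nor x = x by rewrite /nor => ->; rewrite invr1 scale1r.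
have norS x : x != 0 -> sphere n.+2 1 (nor x).
  move=> x0; rewrite /sphere/= enormZ ger0_norm ?invr_ge0 ?enorm_ge0// mulVf//.
  by rewrite enorm_eq0.
pose seg (p q : 'rV[R]_n.+2) (t : R) := (1 - t) *: p + t *: q.
have seg0 p q t : sphere n.+2 1 p -> A p q -> 0 <= t <= 1 -> seg p q t != 0.
  move=> pS [qS qp] /andP[t0 t1]; apply: contra qp.
  rewrite /seg addrC addr_eq0 => /eqP tq.
  have tt : t = 1 - t.
    have := congr1 (@enorm R _) tq; rewrite -scaleNr !enormZ normrN pS qS !mulr1.
    by rewrite !ger0_norm// subr_ge0.
  have t2 : t != 0 by apply/eqP => t2; move: tt; rewrite t2 subr0 => /eqP; rewrite eq_sym oner_eq0.
  by rewrite -(scalerK t2 q) tq -tt scalerN scalerK.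
have Ac p : sphere n.+2 1 p -> p != - p -> connected (A p).
  move=> pS pp.
  have -> : A p = \bigcup_(q in A p) ((nor \o seg p q) @` `[0, 1]).
    apply/seteqP; split => [q Aq|y [q Aq [t t01 <-]]].
      exists q => //; exists 1; first by rewrite /= in_itv/= ler01 lexx.
      by rewrite /= /seg subrr scale0r add0r scale1r norE//; case: Aq.
    rewrite /= in_itv/= in t01.
    split; first by apply: norS; exact: seg0.
    apply/eqP => /= np; have [t0 t1] := andP t01.
    have := congr1 (fun u => enorm (seg p q t) *: u) np; rewrite /nor scalerA.
    rewrite mulfV ?enorm_eq0 ?seg0// scale1r scalerN => /eqP.
    rewrite -addr_eq0 /seg addrAC -scalerDl addr_eq0 => /eqP sp.
    have [qS /negP] := Aq; apply.
    have /eqP := congr1 (@enorm R _) sp; rewrite -scaleNr !enormZ pS qS !mulr1 normrN.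
    have s0 : 0 <= 1 - t + enorm (seg p q t) by rewrite addr_ge0 ?subr_ge0 ?enorm_ge0.
    rewrite !ger0_norm// => /eqP st.
    have [t2|t2] := eqVneq t 0.
      have : 0 < 1 - t + enorm (seg p q t) by rewrite t2 subr0 ltr_pwDl ?enorm_ge0.
      by rewrite st t2 ltxx.
    by rewrite -(scalerK t2 q) -[t *: q]opprK -sp st scalerN scalerK.
  apply: bigcup_connected => [|q Aq].
    exists p => q Aq; exists 0; first by rewrite /= in_itv/= ler01 lexx.
    by rewrite /= /seg subr0 scale0r addr0 scale1r norE.
  apply: connected_continuous_connected; first exact: segment_connected.
  apply/subspace_continuousP => t; rewrite /= in_itv/= => t01.
  apply: (@cvg_trans _ ((nor \o seg p q) @ nbhs t)).
    by apply: cvg_app; exact: cvg_within.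
  have segc : seg p q s @[s --> t] --> seg p q t.
    apply: cvgD; apply: cvgZl => //; apply: cvgB => //; exact: cvg_cst.
  apply: cvgZ => //; apply: cvgV; first by rewrite enorm_eq0 seg0.
  exact: cvg_enorm.
pose p : 'rV[R]_n.+2 := delta_mx 0 0.
pose q : 'rV[R]_n.+2 := delta_mx 0 1.
have pS : sphere n.+2 1 p.
  apply/enorm_eq => //; rewrite dotE (bigD1 0)//= big1 => [|i i0]; rewrite !mxE /=.
    by rewrite mulr1 addr0 expr1n.
  by rewrite (negbTE i0) mulr0.
have qS : sphere n.+2 1 q.
  apply/enorm_eq => //; rewrite dotE (bigD1 1)//= big1 => [|i i0]; rewrite !mxE /=.
    by rewrite mulr1 addr0 expr1n.
  by rewrite (negbTE i0) mulr0.
have pNp : p != - p.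
  apply/eqP => /rowP/(_ 0); rewrite !mxE /= => /eqP.
  by rewrite -addr_eq0 -natrD pnatr_eq0.
have NpS : sphere n.+2 1 (- p) by rewrite /sphere /= -scaleN1r enormZ normrN1 mul1r.
have -> : sphere n.+2 1 = A p `|` A (- p).
  apply/seteqP; split=> [y yS|y [] []//].
  have [->|yp] := eqVneq y (- p); [right|left]; split => //.
  by rewrite opprK eq_sym.
apply: connectedU.
- exists q; split; split => //.
  + by apply/eqP => /rowP/(_ 1); rewrite !mxE /= oppr0 => /eqP; rewrite oner_eq0.
  + by apply/eqP => /rowP/(_ 1); rewrite !mxE /= opprK => /eqP; rewrite oner_eq0.
- exact: Ac.
- by apply: Ac => //; rewrite opprK eq_sym.
Qed.

End Models.

(** * Embedded disks of codimension zero are open *)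

Section OpenEmbedding.
Variable R : realType.

Lemma closed_sphere n r : closed (sphere n r : set 'rV[R]_n).
Proof.
rewrite (_ : sphere n r = @enorm R n @^-1` [set r]); last by [].
by apply: closed_comp => [x _|]; [exact: enorm_continuous|exact: closed_eq].
Qed.

Lemma closed_cdisk n r : closed (cdisk n r : set 'rV[R]_n).
Proof.
rewrite (_ : cdisk n r = @enorm R n @^-1` [set y | y <= r]); last by [].
by apply: closed_comp => [x _|]; [exact: enorm_continuous|exact: closed_le].
Qed.

Lemma compact_cdisk n r : compact (cdisk n r : set 'rV[R]_n).
Proof.
apply: bounded_closed_compact; last exact: closed_cdisk.
exists r; split; first exact: num_real.
by move=> M rM x xr /=; apply: le_trans (norm_le_enorm x) (le_trans xr (ltW rM)).
Qed.

Lemma sphere_sub_cdisk n r : sphere n r `<=` (cdisk n r : set 'rV[R]_n).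
Proof. by move=> x; rewrite /sphere /cdisk /= => ->. Qed.

Lemma compact_sphere n r : compact (sphere n r : set 'rV[R]_n).
Proof.
apply: subclosed_compact (@closed_sphere n r) (@compact_cdisk n r) _.
exact: sphere_sub_cdisk.
Qed.

Lemma compact_smooth_image n m (X : set 'rV[R]_n) (f : 'rV[R]_n -> 'rV[R]_m) :
  compact X -> smooth_on X f -> compact (f @` X).
Proof. by move=> cX sf; apply: continuous_compact => //; exact: smooth_on_continuous. Qed.

Lemma smooth_onS n m (X Y : set 'rV[R]_n) (f : 'rV[R]_n -> 'rV[R]_m) :
  X `<=` Y -> smooth_on Y f -> smooth_on X f.
Proof.
move=> XY sf x /XY /sf [U [g [oU Ux Ug gf]]].
by exists U, g; split => // y /XY; exact: gf.
Qed.

Lemma compact_closed_rV n (X : set 'rV[R]_n) : compact X -> closed X.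
Proof. by apply: compact_closed; exact: norm_hausdorff. Qed.

(** The [n] independent rows of [A] span a hyperplane, whose orthogonal is a line. *)
Lemma colinear_of_hyperplane n (A : 'M[R]_(n, n.+1)) (u v : 'rV[R]_n.+1) :
  row_free A -> u *m A^T = 0 -> v *m A^T = 0 -> u != 0 -> exists a, v = a *: u.
Proof.
move=> Af uA vA u0; apply/sub_rVP.
have uK : (u <= kermx A^T)%MS by exact/sub_kermxP.
have vK : (v <= kermx A^T)%MS by exact/sub_kermxP.
apply: submx_trans vK _.
rewrite -(mxrank_leqif_sup uK) mxrank_ker mxrank_tr rank_rV u0.
by move/eqP: Af => ->; rewrite subSnn.
Qed.

Lemma near_enorm n (y : 'rV[R]_n) (P : set 'rV[R]_n) : nbhs y P ->
  exists2 d, 0 < d & forall w, dot (w - y) (w - y) < d -> P w.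
Proof.
move=> /nbhs_normP [e /= e0 eP]; exists (e ^+ 2); first exact: exprn_gt0.
move=> w; rewrite -enorm_lt ?ltW// => we; apply: eP => /=.
by rewrite -normrN opprB (le_lt_trans (norm_le_enorm _)).
Qed.

Lemma near_dot_lt n (y : 'rV[R]_n) (d : R) : 0 < d ->
  \forall w \near y, dot (w - y) (w - y) < d.
Proof.
move=> d0; have : (fun w : 'rV[R]_n => dot (w - y) (w - y)) @ nbhs y --> dot (y - y) (y - y).
  have sub : (fun w : 'rV[R]_n => w - y) @ nbhs y --> y - y.
    by apply: cvgB; [exact: cvg_id|exact: cvg_cst].
  exact: cvg_dot.
by move=> yy; apply: (cvgr_lt _ yy); rewrite subrr /dot mul0mx mxE.
Qed.

(** A substitute for the triangle inequality, with no square roots. *)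
Lemma dot_parallelogram n (u v : 'rV[R]_n) :
  dot (u + v) (u + v) <= 2 * dot u u + 2 * dot v v.
Proof.
have := dot_ge0 (u - v); rewrite !(dotDl, dotDr, dotNl, dotNr) (dotC v u).
lra.
Qed.

(** Invariance of domain for a smoothly embedded disk.  Let [y0 = e v0] with [v0] in
the open disk, and let [y'] be a point of the sphere very close to [y0].  A point
[e v'] of the embedded closed disk nearest to [y'] is not on the image of the
bounding sphere, which stays away from [y0].  So [v'] is interior and
[e v' - y'] is orthogonal to the image of the derivative [D] of [e].  That image is
the whole tangent hyperplane, since [e] has a smooth inverse; thus [y'] is a
multiple of [e v'], and being close to it, equal to it. *)
Lemma closed_sphere_minus_disk n (e : 'rV[R]_n -> 'rV[R]_n.+1) :
  embedding (cdisk n 1) e -> e @` cdisk n 1 `<=` sphere n.+1 1 ->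
  closed (sphere n.+1 1 `\` e @` odisk n 1).
Proof.
move=> [es _ [g [gs gD gK _]]] eS y0 cly0; split.
  exact: (@closed_sphere n.+1 1 _ (closure_subset (@subDsetl _ _ _) cly0)).
move=> [v0 v01 ev0].
have v0D : cdisk n 1 v0 by exact: ltW.
have einj v w : cdisk n 1 v -> cdisk n 1 w -> e v = e w -> v = w.
  by move=> vD wD evw; rewrite -(gK v)// evw gK.
(* The image of the bounding sphere avoids a ball around y0, of squared radius d. *)
have sD := @sphere_sub_cdisk n 1.
have Kc : closed (e @` sphere n 1).
  apply: compact_closed_rV; apply: compact_smooth_image (@compact_sphere n 1) _.
  exact: smooth_onS sD es.
have : nbhs y0 (~` (e @` sphere n 1)).
  apply: open_nbhs_nbhs; split; first exact: closed_openC.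
  move=> [v v1 /esym]; rewrite -ev0 => /(einj _ _ v0D (sD _ v1)) v0v.
  by move: v01; rewrite /odisk/= v0v v1 ltxx.
move=> /near_enorm[d d0 dK].
(* Squared distance below d / 4 makes the nearest point interior; below 4 it excludes
   the antipode at the end. *)
have [y' [[y'S y'e]]] : exists y', (sphere n.+1 1 `\` e @` odisk n 1) y' /\
    (dot (y' - y0) (y' - y0) < d / 4 /\ dot (y' - y0) (y' - y0) < 4).
  have d4 : 0 < d / 4 by rewrite divr_gt0.
  have p4 : (0 : R) < 4 by rewrite ltr0n.
  have [y' [? ?]] := cly0 _ (filterI (near_dot_lt y0 d4) (near_dot_lt y0 p4)).
  by exists y'.
move=> [y'd y'4]; apply: y'e.
pose rho v := dot (e v - y') (e v - y').
have rhoc : {within cdisk n 1, continuous rho}.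
  apply/subspace_continuousP => v vD.
  have ev := (subspace_continuousP _ _).1 (smooth_on_continuous es) v vD.
  by apply: cvg_dot; (apply: cvgB; [|exact: cvg_cst]) => //.
have [v' v'D v'min] := EVT_min_rV (ex_intro _ v0 v0D) (@compact_cdisk n 1) rhoc.
have {v'D}v'D : cdisk n 1 v' by rewrite inE in v'D.
have {}v'min v : cdisk n 1 v -> rho v' <= rho v by move=> vD; apply: v'min; rewrite inE.
have rho4 : rho v' <= dot (y' - y0) (y' - y0).
  by rewrite (le_trans (v'min _ v0D))// /rho ev0 -opprB dotNl dotNr opprK.
have v'1 : enorm v' < 1.
  rewrite lt_neqAle v'D andbT; apply/eqP => v'1.
  have : dot (e v' - y0) (e v' - y0) < d.
    rewrite -(subrKA y') (le_lt_trans (dot_parallelogram _ _))//.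
    move: rho4; rewrite /rho; lra.
  by move/dK; apply; exists v'.
exists v' => //.
have [D Dv] := smooth_on_velocity es v'D.
have [E Ev] := smooth_on_velocity gs (imageP e v'D).
have line w : \forall t \near (0 : R)^'+, cdisk n 1 (v' + t *: w).
  by apply: near_line; exact: nbhs_cdisk.
have Dline w := Dv _ _ (line w) (@velocity_line R n v' w).
have DS w : dot (D w) (e v') = 0.
  apply: (@tangent_sphere_dot _ _ 1); first exact: eS (imageP e v'D).
  exists (e \o (fun t => v' + t *: w)) => //.
  by apply: filterS (line w) => t Dt; apply: eS; exact: imageP.
have Dge w : 0 <= dot (D w) (e v' - y').
  have : velocity (fun t => e (v' + t *: w) - y') (e v' - y') (D w).
    apply: cvg_trans (Dline w); apply: near_eq_cvg; apply: nearW => t /=.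
    by rewrite opprB addrA subrK.
  move=> /velocity_dot/(ler_cvg_to (cvg_cst 0)) H.
  have {}H : 0 <= 2 * dot (D w) (e v' - y').
    apply: H; near=> t.
    rewrite mulr_ge0 ?invr_ge0 ?subr_ge0//.
      by apply: v'min; near: t; exact: line.
  lra.
have Dy w : dot (D w) y' = 0.
  have := Dge w; have := Dge (- w); have := DS w.
  rewrite linearN dotNl !(dotDr, dotNr); lra.
have ED w : E (D w) = w.
  have eline : \forall t \near (0 : R)^'+, (e @` cdisk n 1) (e (v' + t *: w)).
    by apply: filterS (line w) => t; exact: imageP.
  apply: (velocity_unique (Ev _ _ eline (Dline w))); rewrite gK//.
  apply: velocity_near_eq (@velocity_line R n v' w).
  by apply: filterS (line w) => t Dt /=; rewrite gK.
have Af : row_free (lin1_mx D).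
  apply/row_freeP; exists (lin1_mx E); apply/row_matrixP => i.
  by rewrite rowE mulmxA !mul_rV_lin1/= ED row1.
have Az u : (forall w, dot (D w) u = 0) -> u *m (lin1_mx D)^T = 0.
  move=> Du; apply/rowP => i; rewrite mxE [RHS]mxE -[RHS](Du (delta_mx 0 i)) dotE.
  by apply: eq_bigr => j _; rewrite !mxE mulrC.
have ev'S : dot (e v') (e v') = 1.
  by rewrite -enorm_sqr (eS _ (imageP e v'D)) expr1n.
have y'1 : dot y' y' = 1 by rewrite -enorm_sqr y'S expr1n.
have ev'0 : e v' != 0 by rewrite -dot_eq0 ev'S oner_eq0.
have [a y'a] := colinear_of_hyperplane Af (Az _ DS) (Az _ Dy) ev'0.
have : a ^+ 2 = 1 by move: y'1; rewrite y'a dotZl dotZr ev'S mulr1.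
move/eqP; rewrite sqrf_eq1 => /orP[] /eqP a1; first by rewrite y'a a1 scale1r.
move: (le_lt_trans rho4 y'4).
have -> : rho v' = 4.
  by rewrite /rho y'a a1 scaleN1r opprK !(dotDl, dotDr) ev'S; ring.
by rewrite ltxx.
Unshelve. all: by end_near. Qed.

End OpenEmbedding.

(** * Connected sums with a disconnected summand *)

Section ConnectedSum.
Variable R : realType.

Lemma two_closed_not_connected (T : topologicalType) (A P Q : set T) :
  closed P -> closed Q -> P !=set0 -> Q !=set0 -> P `&` Q = set0 ->
  A = P `|` Q -> ~ connected A.
Proof.
move=> cP cQ [p Pp] [q Qq] PQ -> /(_ P) PQP.
suff PE : P = P `|` Q.
  have : (P `&` Q) q by split => //; rewrite PE; right.
  by rewrite PQ.
apply: PQP; first by exists p.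
  exists (~` Q); first exact: closed_openC.
  apply/seteqP; split=> [y Py|y [[//|Qy] /(_ Qy)[]]].
  by split; [left|move=> Qy; have : (P `&` Q) y by []; rewrite PQ].
exists P => //; apply/seteqP; split=> [y Py|y []//].
by split => //; left.
Qed.

(** The image is an interval, and an interval containing two distinct natural
numbers also contains the half-integer after the smaller one. *)
Lemma continuous_nat_connected (T : topologicalType) (A : set T) (l : T -> R) y z :
  connected A -> {within A, continuous l} ->
  (forall y, A y -> exists i : nat, l y = i%:R) -> A y -> A z -> l y = l z.
Proof.
move=> Ac lc lnat Ay Az.
wlog lt_yz : y z Ay Az / l y < l z => [wlt|].
  by have [/wlt|/wlt/esym|//] := ltgtP (l y) (l z); exact.
have /connected_intervalP lI := connected_continuous_connected Ac lc.
have [[i yi] [j zj]] := (lnat y Ay, lnat z Az).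
have ij : (i < j)%N by move: lt_yz; rewrite yi zj ltr_nat.
have ij' : i.+1%:R <= j%:R :> R by rewrite ler_nat.
have [w Aw wE] : (l @` A) (i%:R + 2^-1).
  apply: (lI (l y) (l z)); [exact: imageP|exact: imageP|].
  rewrite yi zj; rewrite -natr1 in ij'; apply/andP; split; lra.
have [m wm] := lnat w Aw; rewrite wm in wE.
have : (i < m)%N by rewrite -(ltr_nat R) wE; lra.
have : (m < i.+1)%N by rewrite -(ltr_nat R) wE -(natr1 i); lra.
by rewrite ltnS leqNgt => /negP.
Qed.

Lemma compact_preimage n (K : set 'rV[R]_n) (l : 'rV[R]_n -> R) (C : set R) :
  compact K -> {within K, continuous l} -> closed C -> compact (K `&` l @^-1` C).
Proof.
move=> Kc lc Cc.
move/continuous_closedP/(_ _ Cc)/closed_subspaceP: lc => [V Vc VK].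
have -> : K `&` l @^-1` C = V `&` K by rewrite setIC -VK.
apply: (subclosed_compact _ Kc); last exact: subIsetr.
by apply: closedI => //; exact: compact_closed_rV.
Qed.

Lemma sphere_nonempty n : sphere n.+1 (1 : R) !=set0.
Proof.
exists (delta_mx 0 0); apply/enorm_eq => //.
rewrite dotE (bigD1 0)//= big1 => [|i i0]; rewrite !mxE /=.
  by rewrite mulr1 addr0 expr1n.
by rewrite (negbTE i0) mulr0.
Qed.

(** The function [l] labels the components of [L1].  It is constant on the disk cut
out of [L1], since that disk is star-shaped, so the components with a label other
than [l x1] are carried whole into [J].  Their union [P] and the rest [Q] of [J] are
disjoint, because gluing only happens on the boundary of the disk.  Both are
compact: the complements of the open disks in the spheres are closed, by
[closed_sphere_minus_disk]. *)
Lemma connected_sum_not_connected p d (L1 L2 J : oset R (p + d.+1).+1 d.+1)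
    (x1 x2 : 'rV[R]_(p + d.+1).+1) (l : 'rV[R]_(p + d.+1).+1 -> R) y0 :
  connected_sum L1 L2 x1 x2 J -> closed L1 -> closed L2 ->
  L1 `<=` sphere (p + d.+1).+1 1 -> L2 `<=` sphere (p + d.+1).+1 1 ->
  {within L1, continuous l} -> (forall y, carrier L1 y -> exists i : nat, l y = i%:R) ->
  carrier L1 y0 -> l y0 != l x1 -> ~ connected J.
Proof.
move=> [e1 [e2 [i1 [i2 [[D1 D2] [I1 I2] [_ glue] [JE _] _]]]]].
pose S : set 'rV[R]_(p + d.+1).+1 := sphere (p + d.+1).+1 1.
pose A1 := S `\` e1 @` odisk (p + d.+1) 1; pose A2 := S `\` e2 @` odisk (p + d.+1) 1.
rewrite -[osphere _ _ `\` e1 @` _]/A1 -[osphere _ _ `\` e2 @` _]/A2 in I1 I2 glue JE.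
move=> cL1 cL2 L1S L2S lc lnat Ly0 ly0.
have [[E1 e1S] e10 e1L _ _] := D1; have [[E2 e2S] _ _ _ _] := D2.
have [e1s _ [g1 [_ _ g1K _]]] := E1.
have A1c : closed A1 by exact: closed_sphere_minus_disk.
have A2c : closed A2 by exact: closed_sphere_minus_disk.
have compL (L : oset R (p + d.+1).+1 d.+1) : closed L -> L `<=` S -> compact L.
  by move=> cL LS; exact: subclosed_compact cL (@compact_sphere R _ 1) LS.
have lcst y v : carrier L1 y -> cdisk (p + d.+1) 1 v -> y = e1 v -> l y = l x1.
  move=> Ly vD yE; rewrite yE in Ly *; rewrite -e10.
  have v0 : lsubmx v = 0 by exact/(e1L v vD).
  have tD t : 0 <= t <= 1 -> cdisk (p + d.+1) 1 (t *: v).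
    move=> /andP[t0 t1]; rewrite /cdisk/= enormZ ger0_norm//.
    by rewrite (le_trans (ler_piMl _ t1)) ?enorm_ge0.
  have tL t : 0 <= t <= 1 -> carrier L1 (e1 (t *: v)).
    by move=> t01; apply/e1L; [exact: tD|rewrite linearZ/= v0 scaler0].
  have := @continuous_nat_connected _ `[(0 : R), 1] (fun t => l (e1 (t *: v))) 1 0.
  rewrite scale1r scale0r; apply.
  - exact: segment_connected.
  - apply/subspace_continuousP => t; rewrite /= in_itv/= => t01.
    have near01 : within `[(0 : R), 1] (nbhs t) (fun s => 0 <= s <= 1).
      by rewrite /within/=; apply: nearW => s; rewrite in_itv.
    have e1t : e1 (s *: v) @[s --> within `[(0 : R), 1] (nbhs t)] --> e1 (t *: v).
      apply: (smooth_on_cvg e1s (tD _ t01)).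
        by apply: filterS near01 => s; exact: tD.
      by apply: cvgZl; apply: cvg_within.
    apply: cvg_trans ((subspace_continuousP _ _).1 lc _ (tL _ t01)).
    move=> B; rewrite /within/= => LB; have := e1t _ LB.
    apply: filterS2 near01 => s s01; apply; exact: tL.
  - by move=> t; rewrite /= in_itv/= => /tL; exact: lnat.
  - by rewrite /= in_itv/= ler01 lexx.
  - by rewrite /= in_itv/= ler01 lexx.
have [i1s _ [h1 [_ _ h1K _]]] := I1; have [i2s _ _] := I2.
pose P := i1 @` [set y | carrier L1 y /\ l y != l x1].
pose Q := i1 @` ((L1 `&` l @^-1` [set l x1]) `&` A1) `|` i2 @` (L2 `&` A2).
have PA1 : [set y | carrier L1 y /\ l y != l x1] `<=` A1.
  move=> y [Ly ly]; split; first exact: L1S.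
  by move=> [v v1 /esym yE]; case/eqP: ly; apply: lcst yE => //; exact: ltW.
have [i0 xi0] : exists i : nat, l x1 = i%:R.
  apply: lnat; rewrite -e10; apply/e1L; rewrite ?linear0// /cdisk/= enorm0.
  exact: ler01.
apply: (@two_closed_not_connected _ _ P Q).
- apply: compact_closed_rV; apply: compact_smooth_image; last exact: smooth_onS PA1 i1s.
  (* As l takes natural values, avoiding l x1 = i0 means avoiding an open ball. *)
  have -> : [set y | carrier L1 y /\ l y != l x1] =
      L1 `&` l @^-1` (~` ball (i0%:R : R) 1).
    apply/seteqP; split => y [Ly] /=; rewrite -ball_normE /= xi0.
      have [m ->] := lnat y Ly => mi; split => // /=.
      apply/negP; rewrite -leNgt.
      have := mi; rewrite eqr_nat neq_ltn => /orP[] im.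
        rewrite -natrB 1?ltnW// normr_nat ler1n subn_gt0//.
      by rewrite distrC -natrB 1?ltnW// normr_nat ler1n subn_gt0.
    move=> ny; split => //; apply/eqP => ly; apply: ny.
    by rewrite ly subrr normr0.
  apply: compact_preimage => //; first exact: compL.
  by apply: open_closedC; exact: ball_open.
- apply: compact_closed_rV; apply: compactU; apply: compact_smooth_image.
  + apply: compact_closedI => //.
    by apply: compact_preimage; [exact: compL|exact: lc|exact: closed_eq].
  + by apply: smooth_onS i1s => y [].
  + by apply: compact_closedI => //; exact: compL.
  + by apply: smooth_onS i2s => y [].
- by exists (i1 y0); exists y0.
- have [u u1] := sphere_nonempty d.
  pose v : 'rV[R]_(p + d.+1) := row_mx 0 u.
  have v1 : enorm v = 1.
    by apply/enorm_eq => //; rewrite dot_row_mx -!enorm_sqr enorm0 u1 expr0n/= add0r.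
  have vD : cdisk (p + d.+1) 1 v by rewrite /cdisk/= v1.
  have Lv : carrier L1 (e1 v) by apply/e1L => //; rewrite row_mxKl.
  exists (i1 (e1 v)); left; exists (e1 v) => //; split.
    by split => //; exact: lcst Lv vD _.
  split; first exact: L1S.
  move=> [w w1 wv]; have wD : cdisk (p + d.+1) 1 w by exact: ltW.
  have : w = v by rewrite -(g1K _ wD) wv g1K.
  by move=> wE; move: w1; rewrite /odisk/= wE v1 ltxx.
- apply/seteqP; split => // z [[y [Ly ly] <-]] [[y' [[Ly' ly'] A1y']]|[y' [Ly' A2y']]].
    move=> i1E; have yy' : y' = y by rewrite -(h1K _ A1y') i1E h1K//; exact: PA1.
    by move: ly; rewrite -yy' ly' eqxx.
  move=> /esym/(glue _ _ (PA1 _ (conj Ly ly)) A2y').1 [v [v1 yE _]].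
  by case/eqP: ly; apply: lcst yE => //; rewrite /cdisk/= v1.
- rewrite JE /P /Q setUA; congr (_ `|` _).
  rewrite -image_setU; congr (_ @` _); apply/seteqP; split => [y [Ly A1y]|y].
    by have [ly|ly] := eqVneq (l y) (l x1); [right|left].
  by move=> [[Ly ly]|[[Ly _] A1y]]; split => //; exact: PA1.
Qed.

End ConnectedSum.

(** * The boundary of the Milnor fiber *)

Section MilnorFiber.
Variable R : realType.

Lemma differentiable_bigsum (V W : normedModType R) (I : Type) (s : seq I)
    (F : I -> V -> W) x :
  (forall i, differentiable (F i) x) ->
  differentiable (fun y => \sum_(i <- s) F i y) x.
Proof.
move=> dF; elim: s => [|i s IH].
  by under eq_fun do rewrite big_nil; exact: differentiable_cst.
by under eq_fun do rewrite big_cons; exact: differentiableD.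
Qed.

Lemma differentiable_bigprod (V : normedModType R) (I : Type) (s : seq I)
    (F : I -> V -> R) x :
  (forall i, differentiable (F i) x) ->
  differentiable (fun y => \prod_(i <- s) F i y) x.
Proof.
move=> dF; elim: s => [|i s IH].
  by under eq_fun do rewrite big_nil; exact: differentiable_cst.
by under eq_fun do rewrite big_cons; exact: differentiableM.
Qed.

Lemma differentiable_polymap n p (F : 'I_p -> mpoly.mpoly n R) x :
  differentiable (polymap F) x.
Proof.
have -> : polymap F = fun y => \sum_i
    mpoly.meval (fun j => y 0 j) (F i) *: (delta_mx 0 i : 'rV[R]_p).
  by apply/funext => y; rewrite [LHS]row_sum_delta; apply: eq_bigr => i _; rewrite mxE.
apply: differentiable_bigsum => i; apply: differentiableZl.
under eq_fun do rewrite mpoly.mevalE.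
apply: differentiable_bigsum => m; apply: differentiableM => //.
apply: differentiable_bigprod => j.
have dj : differentiable (fun y : 'rV[R]_n => y 0 j) x by exact: differentiable_coord.
elim: (mpoly.fun_of_multinom m j) => [|k IH].
  by under eq_fun do rewrite expr0; exact: differentiable_cst.
by under eq_fun do rewrite exprS; exact: differentiableM.
Qed.

(** Where [a < enorm (f z)] the total space is locally the whole sphere.  Where
equality holds, the trivialization [c] of the tube provides a curve in the tube
along which [f] shrinks radially, so that its velocity [v] satisfies
['d f z v = - f z].  Then [- v] is tangent to the total space, since the norm of [f]
increases along it, while [v] is not. *)
Lemma two_sided_milnor_total n p (f : 'rV[R]_n -> 'rV[R]_p) (e a : R) c z :
  0 < e -> 0 < a -> (forall x, differentiable f x) ->
  let S := sphere n e in
  let N := [set x | S x /\ enorm (f x) <= a] in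
  tubular S [set x | S x /\ f x = 0] N c ->
  (forall x, N x -> rsubmx (c x) = a^-1 *: f x) ->
  milnor_total f e a z ->
  two_sided (milnor_total f e a) z <-> a < enorm (f z).
Proof.
move=> e0 a0 df S N [NS _ cN _] cf [Sz az].
split=> [Ez2|{}az]; last first.
  apply: (@two_sided_near _ _ S); last exact: two_sided_sphere.
  have : enorm (f y) @[y --> z] --> enorm (f z).
    exact: cvg_comp (differentiable_continuous (df z)) (@enorm_continuous R p _).
  move=> /cvgr_gt/(_ _ az); apply: filterS => y ay.
  by split=> [Sy|[]//]; split => //; exact: ltW.
rewrite lt_neqAle az andbT; apply/eqP => az'.
have fz : dot (f z) (f z) = a ^+ 2 by rewrite -enorm_sqr -az'.
have Nz : N z by split => //; rewrite -az'.
have [cs cNK [d [ds dN cK dK]]] := cN.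
(* In the trivialization, move radially from the boundary to the center of the disk. *)
pose w : 'rV[R]_(n + p) := row_mx 0 (- (a^-1 *: f z)).
have [Kcz b1] := cNK _ Nz; rewrite cf// in b1.
have line : \forall t \near (0 : R)^'+,
    prodset [set x | S x /\ f x = 0] (cdisk p 1) (c z + t *: w).
  near=> t; split; first by rewrite linearD linearZ/= row_mxKl scaler0 addr0.
  rewrite linearD linearZ/= row_mxKr cf// /cdisk/=.
  have t0 : 0 < t by near: t; exact: nbhs_right_gt.
  have t1 : t <= 1 by near: t; exact: nbhs_right_le.
  rewrite scalerN -[X in X - _]scale1r -scalerBl enormZ ger0_norm ?subr_ge0//.
  by rewrite mulr_ile1 ?enorm_ge0 ?subr_ge0// lerBlDr lerDl ltW.
have [D Dv] := smooth_on_velocity ds (cNK _ Nz).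
have := Dv _ _ line (@velocity_line R _ (c z) w); rewrite cK//.
set v := D w; set g := _ \o _ => gv.
have gN : \forall t \near (0 : R)^'+, N (g t) by apply: filterS line => t; exact: dN.
have dfv : 'd f z v = - f z.
  apply: (velocity_unique (velocity_diff (df z) gv)).
  apply: velocity_near_eq (@velocity_line R _ (f z) (- f z)).
  apply: filterS line => t Pt; rewrite /=.
  have : rsubmx (c (g t)) = a^-1 *: f (g t) by apply: cf; exact: dN.
  rewrite /g /= dK// linearD linearZ/= row_mxKr cf// => /(congr1 (fun u => a *: u)).
  rewrite scalerDr !scalerA mulfV ?gt_eqF// !scale1r => <-.
  by rewrite !scalerN !scalerA mulrAC mulfV ?gt_eqF// mul1r.
have [g1 g1S g1v] : tangent S z (- v).
  by apply: two_sided_sphere => //; exists g => //; apply: filterS gN => t /NS.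
have : tangent (milnor_total f e a) z (- v).
  exists g1 => //; have := velocity_dot (velocity_diff (df z) g1v).
  rewrite linearN dfv opprK fz => /cvgr_gt/(_ 0).
  rewrite mulr_gt0 ?exprn_gt0// => /(_ isT) g1gt; near=> t.
  have t0 : 0 < t by near: t; exact: nbhs_right_gt.
  split; first by near: t.
  rewrite -ler_sqr ?nnegrE ?(ltW a0) ?enorm_ge0// enorm_sqr -subr_ge0.
  rewrite -(@pmulr_rge0 _ t^-1) ?invr_gt0// ltW//; near: t; exact: g1gt.
move=> /Ez2; rewrite opprK => -[g2 g2E g2v].
have := velocity_dot (velocity_diff (df z) g2v).
rewrite dfv dotNl fz => /(ler_cvg_to (cvg_cst 0)) H.
suff : 0 <= 2 * - a ^+ 2 by rewrite mulrN oppr_ge0 leNgt mulr_gt0 ?exprn_gt0.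
apply: H; near=> t.
have t0 : 0 < t by near: t; exact: nbhs_right_gt.
have [_ ag2] : milnor_total f e a (g2 t) by near: t.
rewrite mulr_ge0 ?invr_ge0 ?(ltW t0)// subr_ge0 -enorm_sqr.
by rewrite ler_sqr ?nnegrE ?(ltW a0) ?enorm_ge0.
Unshelve. all: by end_near. Qed.

Lemma within_continuous_comp n (T U : topologicalType) (X : set 'rV[R]_n)
    (f : 'rV[R]_n -> T) (g : T -> U) :
  {within X, continuous f} -> continuous g -> {within X, continuous (g \o f)}.
Proof.
move=> fc gc; apply/subspace_continuousP => x Xx.
by apply: cvg_comp ((subspace_continuousP _ _).1 fc x Xx) (gc _).
Qed.

Lemma within_continuous_smooth n m (T : topologicalType) (X : set 'rV[R]_n)
    (Y : set 'rV[R]_m) (f : 'rV[R]_n -> 'rV[R]_m) (g : 'rV[R]_m -> T) :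
  smooth_on X f -> (forall x, X x -> Y (f x)) -> {within Y, continuous g} ->
  {within X, continuous (g \o f)}.
Proof.
move=> fs XY gc; apply/subspace_continuousP => x Xx.
have fx := (subspace_continuousP _ _).1 (smooth_on_continuous fs) x Xx.
apply: cvg_trans ((subspace_continuousP _ _).1 gc _ (XY _ Xx)).
move=> B YB; have := fx _ YB; rewrite /= /within/= !nbhs_simpl/=.
by apply: filterS => y + Xy; apply => //; exact: XY.
Qed.

(** The local trivialization need not restrict to the identity of the fiber over
[b], only to a bijection; [k] is the inverse of this bijection, and reparametrizes
the fiber.  Since the base is a manifold without boundary, being two-sided in the
total space and in the fiber are equivalent. *)
Lemma fiber_bundle_two_sided n m (E : set 'rV[R]_n) (q : 'rV[R]_n -> 'rV[R]_m) b :
  fiber_bundle E (sphere m 1) q -> sphere m 1 b ->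
  exists k : 'rV[R]_n -> 'rV[R]_n,
    [/\ {within fiber E q b, continuous k}, k @` fiber E q b = fiber E q b &
        forall w, fiber E q b w -> two_sided E (k w) <-> two_sided (fiber E q b) w].
Proof.
move=> [qs _ loc] b1; have [W [h [oW Wb hD hq]]] := loc b b1.
have [hs hP [k [ks kE hK kK]]] := hD.
set M := fiber E q b in hD hs hP ks kE hK kK *.
have row w : M w -> prodset (sphere m 1 `&` W) M (row_mx b w).
  by move=> Mw; split; rewrite ?row_mxKl ?row_mxKr.
have hEb z : E z -> q z = b -> M (rsubmx (h z)) /\ h z = row_mx b (rsubmx (h z)).
  move=> Ez qz; have [_ Mz] : prodset (sphere m 1 `&` W) M (h z).
    by apply: hP; split => //=; rewrite qz.
  by split => //; rewrite -[LHS]hsubmxK hq// qz.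
have kM w : M w -> M (k (row_mx b w)).
  move=> /row Pw; have [Ek qk] := kE _ Pw.
  by split => //; rewrite -hq// kK// row_mxKl.
exists (fun w => k (row_mx b w)); split.
- apply/subspace_continuousP => w Mw.
  apply: (smooth_on_cvg ks (row _ Mw)).
    by apply: filterS (withinT M (nbhs_filter w)) => u; exact: row.
  by apply: cvg_row_mx; [exact: cvg_cst|exact: cvg_within].
- apply/seteqP; split=> [_ [w Mw <-]|z [Ez qz]]; first exact: kM.
  have [Mz hz] := hEb z Ez qz; exists (rsubmx (h z)) => //.
  by rewrite -hz hK//; split => //=; rewrite qz.
- move=> w Mw; have [Ek qk] := kM _ Mw.
  have E0k : (E `&` q @^-1` W) (k (row_mx b w)) by exact: kE (row _ Mw).
  have Enear : \forall y \near k (row_mx b w), (E `&` q @^-1` W) y <-> E y.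
    have [q' [dq' q'k q'q]] := smooth_on_diff qs Ek.
    have Wq : nbhs (q' (k (row_mx b w))) W.
      by apply: open_nbhs_nbhs; split => //; rewrite q'k qk.
    apply: filterS2 q'q (differentiable_continuous dq' Wq) => y qy Wy.
    by split=> [[]//|Ey]; split => //=; rewrite -qy.
  have twoE : two_sided (E `&` q @^-1` W) (k (row_mx b w)) <-> two_sided E (k (row_mx b w)).
    split; first exact: two_sided_near.
    by apply: two_sided_near; apply: filterS Enear => y; exact: iff_sym.
  apply: (iff_trans (iff_sym twoE)).
  apply: (iff_trans (diffeo_two_sided hD E0k)); rewrite kK; last exact: row.
  rewrite -[w in two_sided M w](row_mxKr b); apply: two_sided_prodset.
    by rewrite row_mxKl.
  rewrite row_mxKl; apply: (@two_sided_near _ _ (sphere m 1)); last exact: two_sided_sphere.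
  by apply: filterS (open_nbhs_nbhs (conj oW Wb)) => y Wy; split=> [|[]//].
Qed.

(** Both ends of the diffeomorphism with the disk characterize boundary points by
[two_sided], so the bounding sphere of the disk corresponds to the part of the
fiber in the boundary of the total space. *)
Lemma connected_fiber_boundary n p m (f : 'rV[R]_n -> 'rV[R]_p) (e a : R)
    (q : 'rV[R]_n -> 'rV[R]_p) b :
  0 < e -> 0 < a -> (forall x, differentiable f x) ->
  milnor_fibration f e a q -> sphere p 1 b ->
  diffeomorphic (fiber (milnor_total f e a) q b) (cdisk m.+2 1) ->
  connected [set z | fiber (milnor_total f e a) q b z /\ enorm (f z) = a].
Proof.
move=> e0 a0 df [[c tub cf] qb _] b1 [g gD].
set E := milnor_total f e a in qb gD *.
have [k [kc kM k2]] := fiber_bundle_two_sided qb b1.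
have [gs gcD [g' [g's g'M gK g'K]]] := gD.
have key y : cdisk m.+2 1 y -> enorm (f (k (g' y))) = a <-> sphere m.+2 1 y.
  move=> yD; have Mg' := g'M _ yD.
  have [Ek _] : fiber E q b (k (g' y)) by rewrite -[X in X _]kM; exact: imageP.
  have : a < enorm (f (k (g' y))) <-> enorm y < 1.
    apply: (iff_trans (iff_sym (two_sided_milnor_total e0 a0 df tub cf Ek))).
    apply: (iff_trans (k2 _ Mg')).
    apply: (iff_trans (diffeo_two_sided gD Mg')); rewrite g'K//.
    exact: two_sided_cdisk.
  have [_ ak] := Ek; move: yD; rewrite /cdisk /sphere /= => yD ay.
  split=> [ka|y1]; apply/eqP; apply: contraT => ne.
    have /ay.2 : enorm y < 1 by rewrite lt_neqAle ne.
    by rewrite ka ltxx.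
  have /ay.1 : a < enorm (f (k (g' y))) by rewrite lt_neqAle eq_sym ne.
  by rewrite y1 ltxx.
have -> : [set z | fiber E q b z /\ enorm (f z) = a] = (k \o g') @` sphere m.+2 1.
  apply/seteqP; split=> [z [Mz fz]|_ [y yS <-]].
    have [w Mw wz] : (k @` fiber E q b) z by rewrite kM.
    exists (g w); last by rewrite /= gK.
    by apply/key; [exact: gcD|rewrite gK// wz].
  have yD := sphere_sub_cdisk yS.
  by split; [rewrite -[X in X _]kM; exact: imageP (g'M _ yD)|apply/key].
apply: connected_continuous_connected; first exact: connected_sphere.
apply: within_continuous_smooth kc; last by move=> y /sphere_sub_cdisk; exact: g'M.
exact: smooth_onS (@sphere_sub_cdisk R _ 1) g's.
Qed.

(** On the boundary of the tube [q] is [f] divided by [a], so the boundary of the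
fiber over [b] is the section of the tube [K * D^p] over [b], and the projection to
[K] is onto. *)
Lemma connected_link n p m (f : 'rV[R]_n -> 'rV[R]_p) (e a : R)
    (q : 'rV[R]_n -> 'rV[R]_p) b :
  0 < e -> 0 < a -> (forall x, differentiable f x) ->
  milnor_fibration f e a q -> sphere p 1 b ->
  diffeomorphic (fiber (milnor_total f e a) q b) (cdisk m.+2 1) ->
  connected [set x | sphere n e x /\ f x = 0].
Proof.
move=> e0 a0 df mil b1 /(connected_fiber_boundary e0 a0 df mil b1).
set B := (X in connected X) => cB.
have [[c [NS _ [cs cKD [c' [c's c'N cK c'K]]] _] cf] _ [Phi [_ PhiS Phiq]]] := mil.
pose N := [set x | sphere n e x /\ enorm (f x) <= a].
have BN : B `<=` N by move=> z [[[Sz _] _] fz]; split => //; rewrite fz.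
have -> : [set x | sphere n e x /\ f x = 0] = (lsubmx \o c) @` B.
  apply/seteqP; split=> [x Kx|_ [z Bz <-]]; last first.
    by have [] := cKD _ (BN _ Bz).
  have Px : prodset [set x | sphere n e x /\ f x = 0] (cdisk p 1) (row_mx x b).
    by split; rewrite ?row_mxKl ?row_mxKr//; exact: sphere_sub_cdisk.
  have Nz := c'N _ Px; set z := c' _ in Nz; have [Sz _] := Nz.
  have fz : f z = a *: b.
    have := cf _ Nz; rewrite c'K// row_mxKr => ->.
    by rewrite scalerA mulfV ?gt_eqF// scale1r.
  have fza : enorm (f z) = a by rewrite fz enormZ b1 mulr1 gtr0_norm.
  exists z; last by rewrite /= c'K// row_mxKl.
  have Tz : enorm z <= e /\ enorm (f z) = a by rewrite (Sz : enorm z = e).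
  do 2![split => //]; first by split => //; rewrite fza.
  by rewrite -(PhiS _ Tz Sz) (Phiq _ Tz) fz scalerA mulVf ?gt_eqF// scale1r.
apply: connected_continuous_connected => //.
apply: within_continuous_comp; last exact: continuous_lsubmx.
exact: smooth_on_continuous (smooth_onS BN cs).
Qed.

End MilnorFiber.

Theorem corollary3p9 (R : realType) (k : nat)
  (k_gt0 : (0 < k)%N) (k_even : ~~ odd k)
  (L : oset R (3 + 2).+1 2) (L_NS : NS_pair (p := 3) L)
  (L_spheres : diffeomorphic L (sphere_copies k.+1 3))
  (x : 'rV[R]_(3 + 2).+1) (Lx : carrier L x)
  (J : oset R (3 + 2).+1 2)
  (J_sum : connected_sum (p := 3) L (oreverse L) x x J)
  (F : 'I_3 -> mpoly.mpoly 6 R) (F0 : polymap F 0 = 0)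
  (F_isolated : isolated_critical_point (polymap F))
  (F_pair : associated_pair_iso (p := 3) (d := 2) (polymap F) J) :
  \forall e \near (0 : R)^'+, \forall a \near (0 : R)^'+,
    forall (q : 'rV[R]_6 -> 'rV[R]_3), milnor_fibration (polymap F) e a q ->
    forall b, sphere 3 1 b ->
      ~ diffeomorphic (fiber (milnor_total (polymap F) e a) q b) (cdisk 3 (1 : R)).
Proof.
have [l [ls lS [l' [_ l'L _ l'K]]]] := L_spheres.
pose label (y : 'rV[R]_6) : R := lsubmx (l y : 'rV[R]_(1 + 3)) 0 0.
have label_nat y : carrier L y -> exists i : nat, label y = i%:R.
  by move=> /lS [[i _ li] _]; exists i; rewrite /label li mxE.
have label_cont : {within L, continuous label}.
  apply: (@within_continuous_comp _ _ _ _ _ l (fun v : 'rV[R]_(1 + 3) => lsubmx v 0 0)).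
    exact: smooth_on_continuous.
  move=> v; apply: (@continuous_comp _ _ _ lsubmx (fun u : 'rV[R]_1 => u 0 0)).
    exact: (@continuous_lsubmx R 1 1 3).
  exact: coord_continuous.
(* A component other than that of x: label 1 if x has label 0, label 0 otherwise;
   k > 0 provides both. *)
have [y Ly xy] : exists2 y, carrier L y & label y != label x.
  have [i xi] := label_nat x Lx; have [u u1] := sphere_nonempty R 2.
  pose j := (i == 0)%N : nat.
  pose v : 'rV[R]_(1 + 3) := row_mx (const_mx j%:R) u.
  have Sv : sphere_copies k.+1 3 v.
    split; last by rewrite row_mxKr.
    by exists j; [rewrite /j; case: eqP|rewrite row_mxKl].
  exists (l' v); first exact: l'L.
  by rewrite xi /label l'K// row_mxKl mxE eqr_nat /j; case: i {xi j v Sv}.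
have [LS L_closed _ _] := L_NS.
have J_disc : ~ connected J.
  exact: (@connected_sum_not_connected R 3 1 L (oreverse L) J x x label y).
near=> e; near=> a => q mil b b1 disk; apply: J_disc.
have e0 : 0 < e by near: e; exact: nbhs_right_gt.
have a0 : 0 < a by near: a; exact: nbhs_right_gt.
(* J is the image of the link under the isomorphism of pairs. *)
have [h [[hs _ _] <- _ _]] : pair_iso (osphere (3 + 2) e) (link (p := 3) (polymap F) e)
    (osphere (3 + 2) 1) J by near: e.
apply: connected_continuous_connected.
  exact: (@connected_link R 6 3 1 _ e a q b e0 a0 (@differentiable_polymap R 6 3 F) mil b1 disk).
apply: smooth_on_continuous; apply: smooth_onS hs.
by move=> z [].
Unshelve. all: by end_near. Qed.
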